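(* Let $\Gamma$ be a group and let $\Lambda_1,\Lambda_2\leq\Gamma$ be subgroups. Then the discrete $\Gamma$-space $\Gamma/\Lambda_2$ is $(\Gamma,\Lambda_1)$-amenable if and only if $\Lambda_1$ is co-amenable to $\Lambda_2$ relative to $\Gamma$.
   Context: All groups are discrete. For a set $Y$, let $\operatorname{Prob}(Y):=\{\mu\in\ell^1(Y):\mu\geq 0,\ \|\mu\|_1=1\}$, equipped with the topology of pointwise convergence. If $\Gamma$ acts on $Y$, it acts on $\operatorname{Prob}(Y)$ by $(s\mu)(y)=\mu(s^{-1}y)$. A locally compact $\Gamma$-space is a locally compact Hausdorff space $X$ on which $\Gamma$ acts by homeomorphisms. Given a subgroup $\Lambda\leq\Gamma$, $X$ is called $(\Gamma,\Lambda)$-amenable if there is a net of continuous functions $\mu_i\colon X\to\operatorname{Prob}(\Gamma/\Lambda)$ (where $\Gamma/\Lambda$ is the set of left cosets with the left translation action) such that $\lim_i\sup_{x\in K}\|s\mu_i(x)-\mu_i(sx)\|_1=0$ for all $s\in\Gamma$ and all compact $K\subset X$. Here $\Gamma/\Lambda_2$ carries the discrete topology and the left translation action. Relative co-amenability (Caprace–Monod): $\Lambda_1$ is co-amenable to $\Lambda_2$ relative to $\Gamma$ if, for every action of $\Gamma$ by continuous affine transformations on a non-empty compact convex subset $C$ of a Hausdorff locally convex topological vector space, the existence of a $\Lambda_1$-fixed point in $C$ implies the existence of a $\Lambda_2$-fixed point in $C$. *)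

(* Defs.v *)
From HB Require Import structures.
From mathcomp Require Import all_boot all_order all_algebra.
From mathcomp Require Import all_classical all_reals all_analysis.

Set Implicit Arguments.
Unset Strict Implicit.
Unset Printing Implicit Defensive.

Import Order.TTheory GRing.Theory Num.Theory.
Import numFieldNormedType.Exports.

Local Open Scope classical_set_scope.
Local Open Scope ring_scope.

Definition is_group_action (G : groupType) (X : Type) (a : G -> X -> X) : Prop :=
  (forall x, a 1%g x = x) /\ (forall s t x, a (s * t)%g x = a s (a t x)).

(* Each [lcgact s] is a homeomorphism: [lcgact s^-1] is its continuous inverse. *)
Record lcGspace (G : groupType) := LCGspace {
  lcgsort :> topologicalType ;
  lcgact : G -> lcgsort -> lcgsort ;
  lcgact_action : is_group_action lcgact ;
  lcgact_continuous : forall s, continuous (lcgact s) ;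
  lcg_hausdorff : hausdorff_space lcgsort ;
  lcg_locally_compact : locally_compact [set: lcgsort] }.

Section Cosets.
Variables (G : groupType) (L : groupClosed G).

Definition left_coset (g : G) : set G := [set (g * h)%g | h in [set` L]].

(* As a type, [left_cosets] is the coset space G/L. *)
Definition left_cosets : set (set G) := range left_coset.

Lemma left_cosets_translate (s : G) (A : left_cosets) :
  [set (s * x)%g | x in \val A] \in left_cosets.
Proof.
case: A => A /= /set_mem[g _ <-]; apply/mem_set; exists (s * g)%g => //.
by rewrite image_comp; apply/eq_imagel => h _ /=; rewrite mulgA.
Qed.

Definition coset_act (s : G) (A : left_cosets) : left_cosets :=
  exist (fun B => B \in left_cosets) _ (left_cosets_translate s A).

Lemma coset_act_action : is_group_action coset_act.
Proof.
split=> [A|s t A]; apply/val_inj => /=.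
  by rewrite -[RHS]image_id; apply/eq_imagel => x _; rewrite mul1g.
by rewrite image_comp; apply/eq_imagel => x _ /=; rewrite mulgA.
Qed.

Local Notation X := (discrete_topology left_cosets).

Lemma coset_act_continuous (s : G) : continuous (coset_act s : X -> X).
Proof.
move=> A U /nbhs_singleton UsA.
by rewrite nbhs_principalE; exact/principal_filterP.
Qed.

Lemma coset_locally_compact : locally_compact [set: X].
Proof.
move=> A _; exists [set A].
  by rewrite /within /= nbhs_principalE; exact/principal_filterP.
by split; [exact: compact_set1|exact: discrete_closed].
Qed.

Definition coset_space : lcGspace G :=
  @LCGspace G X coset_act coset_act_action
    coset_act_continuous discrete_hausdorff coset_locally_compact.

End Cosets.

Definition l1norm (R : realType) (Y : choiceType) (f : Y -> R) : \bar R :=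
  \esum_(y in [set: Y]) `|f y|%:E.

(* As a type, [Prob R Y] carries the topology induced by [{ptws Y -> R}],
   i.e., that of pointwise convergence. *)
Definition Prob (R : realType) (Y : choiceType) : set {ptws Y -> R} :=
  [set mu | (forall y, 0 <= mu y) /\ l1norm mu = 1%E].

Arguments Prob : clear implicits.

Definition translate (R : realType) (G : groupType) (Y : Type)
    (a : G -> Y -> Y) (s : G) (mu : Y -> R) : Y -> R :=
  fun y => mu (a s^-1%g y).

Definition directed_set (I : Type) (le : rel I) : Prop :=
  [/\ inhabited I, reflexive le, transitive le &
      forall i j, exists k, le i k && le j k].

Definition net_filter (I : Type) (le : rel I) : set_system I :=
  filter_from [set: I] (fun i => [set j | le i j]).

(* The point 0 is added to the set whose supremum is taken so that the supremum
   over the empty compact set is 0 rather than -oo. *)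
Definition rel_amenable (R : realType) (G : groupType) (L : groupClosed G)
    (X : lcGspace G) : Prop :=
  exists (I : Type) (le : rel I) (mu : I -> X -> Prob R (left_cosets L)),
    [/\ directed_set le,
        forall i, continuous (mu i) &
        forall (s : G) (K : set X), compact K ->
          ereal_sup (0%E |`
            [set l1norm (fun y => translate (@coset_act G L) s (\val (mu i x)) y
                                  - \val (mu i (lcgact s x)) y) | x in K])
            @[i --> net_filter le] --> 0%E].

Definition affine_on (R : realType) (E : lmodType R) (C : set E) (f : C -> C) :
    Prop :=
  forall (t : R) (x y z : C), 0 <= t <= 1 ->
    \val z = t *: \val x + (1 - t) *: \val y ->
    \val (f z) = t *: \val (f x) + (1 - t) *: \val (f y).

Definition has_fixed_point (G : groupType) (L : groupClosed G) (X : Type)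
    (a : G -> X -> X) : Prop :=
  exists x, forall s, s \in L -> a s x = x.

(* [tvsType R] is the type of locally convex topological vector spaces; they are
   presented with a uniform structure, of which only the topology matters here.
   Complex spaces are covered by restriction of scalars.
   The convex set [C] carries the topology induced by [E]. *)
Definition coamenable_relative (R : realType) (G : groupType)
    (L1 L2 : groupClosed G) : Prop :=
  forall (E : tvsType R) (C : set E) (a : G -> C -> C),
    hausdorff_space E -> C !=set0 -> compact C -> convex_set C ->
    is_group_action a ->
    (forall s, continuous (a s)) ->
    (forall s, affine_on (a s)) ->
    has_fixed_point L1 a -> has_fixed_point L2 a.

(* Main.v *)
Require Import Defs.
From HB Require Import structures.
From mathcomp Require Import all_boot all_order all_algebra.
From mathcomp Require Import all_classical all_reals all_analysis.
From mathcomp Require Import ring lra.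

Set Implicit Arguments.
Unset Strict Implicit.
Unset Printing Implicit Defensive.

(** Write Y = G/L1, and call a mean a finitely additive probability on Y, seen
    as a functional on bounded functions.  Both properties say that Y has
    an L2-invariant mean: amenability through almost invariant probabilities,
    co-amenability through fixed points.

    Amenability gives an L2-fixed point (amenable_coamenable).  The values at
    the base point of G/L2 of the maps into Prob(Y) form a net of probabilities
    nu on Y that are asymptotically L2-invariant in l1 norm.  Let c be an
    L1-fixed point of a compact convex set C.  The orbit map gL1 |-> gc sends
    each nu, truncated to a finite set, to a barycenter b in C.  The difference
    sb - b is a combination of points of C with total mass at most
    ||s nu - nu||_1 up to the truncation error (almost_fixed_barycenter).  Along
    an ultrafilter the points b converge by compactness, and the limit is fixed
    by L2, because scaling by coefficients that tend to 0 kills convergent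
    families of points of C.

    Conversely (coamenable_rel_amenable), the means on Y are a compact convex
    set in the product topology, and evaluation at the coset L1 is an L1-fixed
    mean.  Hence there is an L2-invariant mean m.  For finitely many s_i in L2
    and e > 0 there is a probability nu with ||s_i nu - nu||_1 <= e for all i
    (invariant_mean_reiter): otherwise the convex set of all tuples
    (s_i nu - nu)_i in l1(Y)^n stays away from 0, and Hahn-Banach separation
    gives bounded functions g_i with sum_i (g_i(s_i y) - g_i(y)) >= e for all
    y, which contradicts the invariance of m.  Finally, a probability that is
    almost invariant under L2 is spread over G/L2 by coset representatives: set
    mu(x) = g_x nu, where x = g_x L2.  Then s mu(x) - mu(s x) is the translate
    by g_{sx} of k nu - nu, with k = g_{sx}^-1 s g_x in L2. *)

Import Order.TTheory GRing.Theory Num.Theory.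
Import numFieldNormedType.Exports.

Local Open Scope classical_set_scope.
Local Open Scope ring_scope.

(** * The Hahn-Banach theorem and separation in a seminormed space *)

Section HahnBanach.
Variables (R : realType) (V : lmodType R).
Implicit Types (p q : V -> R) (u v : V) (t : R).

(** Only the inequality for positive t is required in the second clause: it
    implies equality, and p 0 = 0, and it is what infima satisfy readily. *)
Definition sublinear p :=
  (forall u v, p (u + v) <= p u + p v) /\
  (forall t u, 0 < t -> p (t *: u) <= t * p u).

Lemma sublinear0 p : sublinear p -> p 0 = 0.
Proof.
move=> [pD pZ]; have := pD 0 0; have := pZ 2^-1 0.
by rewrite scaler0 addr0 invr_gt0 ltr0n => /(_ isT); lra.
Qed.

Lemma sublinearZ p t u : sublinear p -> 0 <= t -> p (t *: u) = t * p u.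
Proof.
move=> sp; rewrite le_eqVlt => /predU1P[<-|t0].
  by rewrite scale0r mul0r sublinear0.
have [_ pZ] := sp; apply/le_anti/andP; split; first exact: pZ.
rewrite -ler_pdivlMl// -[X in p X <= _](scalerK (lt0r_neq0 t0)).
by apply: pZ; rewrite invr_gt0.
Qed.

Lemma sublinearN p u : sublinear p -> - p (- u) <= p u.
Proof.
move=> sp; have [pD _] := sp; have := pD u (- u).
rewrite subrr sublinear0//; lra.
Qed.

(** The three sublinear functionals needed below (the lower bound of a chain,
    the perturbation of a minimal functional, the separating functional) are
    all pointwise infima.  The hypotheses ask for sublinearity only up to a
    change of index. *)
Lemma sublinear_inf (I : Type) (D : set I) (F : I -> V -> R) :
    D !=set0 ->
    (forall v, has_lbound [set F i v | i in D]) ->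
    (forall i j u v, D i -> D j ->
      exists2 k, D k & F k (u + v) <= F i u + F j v) ->
    (forall i t u, D i -> 0 < t ->
      exists2 k, D k & F k (t *: u) <= t * F i u) ->
  exists2 p, sublinear p & forall i v, D i -> p v <= F i v.
Proof.
move=> [i0 Di0] lbF FD FZ; pose p v := inf [set F i v | i in D].
have pF i v : D i -> p v <= F i v.
  by move=> Di; apply: ge_inf => //; exists i.
have Fp x v : (forall i, D i -> x <= F i v) -> x <= p v.
  move=> xF; apply: lb_le_inf; first by exists (F i0 v), i0.
  by move=> _ [i Di <-]; exact: xF.
exists p => //; split=> [u v|t u t0].
- rewrite -lerBlDr; apply: (Fp _ _) => i Di; rewrite lerBlDr -lerBlDl.
  apply: (Fp _ _) => j Dj; rewrite lerBlDl.
  by have [k Dk] := FD _ _ u v Di Dj; apply: le_trans; exact: pF.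
- rewrite -ler_pdivrMl//; apply: (Fp _ _) => i Di; rewrite ler_pdivrMl//.
  by have [k Dk] := FZ _ _ u Di t0; apply: le_trans; exact: pF.
Qed.

(** Zorn's lemma for the reversed pointwise order. *)
Lemma minimal_sublinear p : sublinear p ->
  exists q, [/\ sublinear q, forall v, q v <= p v &
    forall q', sublinear q' -> (forall v, q' v <= q v) -> forall v, q' v = q v].
Proof.
move=> sp; pose T := {q | sublinear q /\ forall v, q v <= p v}.
pose le (q q' : T) := `[< forall v, sval q' v <= sval q v >].
have sT (q : T) : sublinear (sval q) by case: q => q [].
have leT (q : T) v : sval q v <= p v by case: q => q [].
have [|||A Atot|[q [sq qp]] qmin] := @Zorn T le.
- by move=> q; apply/asboolP.
- move=> q r s /asboolP qr /asboolP rs; apply/asboolP => v.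
  exact: le_trans (rs v) (qr v).
- move=> [q hq] [r hr] /asboolP qr /asboolP rq; apply: eq_exist.
  by apply/funext => v; apply/le_anti; rewrite qr rq.
- (* p itself is added to the chain, so that the infimum is over a nonempty
     set. *)
  pose pT : T := exist _ p (conj sp (fun v => lexx (p v))).
  have Aptot : total_on (pT |` A) le.
    by move=> q r [->|Aq] [->|Ar]; [left|left|right|exact: Atot];
      apply/asboolP => v //=; exact: leT.
  have [|v|q r u v Aq Ar|q t u Aq t0|s ss sA] :=
    @sublinear_inf T (pT |` A) (fun q : T => sval q).
  + by exists pT; left.
  + exists (- p (- v)) => _ [q _ <-].
    by apply: le_trans (sublinearN v (sT q)); rewrite lerN2 leT.
  + have [/asboolP rq|/asboolP qr] := Aptot _ _ Aq Ar.
    * exists r => //; have [rD _] := sT r.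
      by apply: (le_trans (rD u v)); rewrite lerD2r rq.
    * exists q => //; have [qD _] := sT q.
      by apply: (le_trans (qD u v)); rewrite lerD2l qr.
  + by exists q => //; have [_] := sT q; apply.
  + exists (exist _ s (conj ss (fun v => sA pT v (or_introl erefl)))) => q Aq.
    by apply/asboolP => v /=; apply: sA; right.
exists q; split=> // q' sq' q'q v.
have q'p w : q' w <= p w by exact: le_trans (q'q w) (qp w).
have /(_ _)/(congr1 sval)/= <- // := qmin (exist _ q' (conj sq' q'p)).
by apply/asboolP.
Qed.

(** A minimal sublinear functional q is linear.  For fixed v, the functional
    u |-> inf over t >= 0 of q (u + t v) - t q v is sublinear and below q, so
    it equals q; taking t = 1 gives q u + q v <= q (u + v). *)
Theorem hahn_banach p : sublinear p ->
  exists f : {linear V -> R^o}, forall v, f v <= p v.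
Proof.
move=> sp; have [q [sq qp qmin]] := minimal_sublinear sp.
have [qD qZ] := sq.
have qDE u v : q (u + v) = q u + q v.
  apply/le_anti; rewrite qD/=.
  have [|w|s t x y s0 t0|s t x s0 t0|r sr rq] := @sublinear_inf R
    [set t | 0 <= t] (fun t w => q (w + t *: v) - t * q v).
  - by exists 0 => /=.
  - exists (- q (- w)) => _ [t /= t0 <-].
    have := qD (w + t *: v) (- w); rewrite addrAC subrr add0r sublinearZ//; lra.
  - exists (s + t) => /=; first exact: addr_ge0.
    have := qD (x + s *: v) (y + t *: v); rewrite addrACA -scalerDl mulrDl; lra.
  - exists (t * s) => /=; first by rewrite mulr_ge0// ltW.
    by rewrite -scalerA -scalerDr sublinearZ ?(ltW t0)// [leRHS]mulrBr mulrA.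
  have rE : r u = q u.
    apply: qmin => // w; have := rq 0 w (lexx 0).
    by rewrite scale0r addr0 mul0r subr0.
  have := rq 1 u ler01; rewrite rE scale1r mul1r; lra.
have qN v : q (- v) = - q v.
  by apply/eqP; rewrite -addr_eq0 addrC -qDE subrr sublinear0.
have qZE t v : q (t *: v) = t * q v.
  have [t0|t0] := leP 0 t; first exact: sublinearZ.
  rewrite -[t]opprK scaleNr qN sublinearZ ?mulNr//; lra.
have ql : linear (q : V -> R^o) by move=> t u v; rewrite qDE qZE.
pose qL := GRing.isLinear.Build R V R^o *:%R q ql.
pose f : {linear V -> R^o} := HB.pack q qL.
by exists f.
Qed.

End HahnBanach.

Definition seminorm (R : realType) (V : lmodType R) (N : V -> R) :=
  (forall u v, N (u + v) <= N u + N v) /\ (forall t v, N (t *: v) = `|t| * N v).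

(** Hahn-Banach applied to v |-> inf of N (v + t a) - t e over t >= 0 and a in
    A.  This is at most N (take t = 0), and at most - e at - a (take t = 1). *)
Lemma seminorm_separation (R : realType) (V : lmodType R) (N : V -> R)
    (A : set V) (e : R) :
    seminorm N -> A !=set0 ->
    (forall t a b, 0 <= t <= 1 -> A a -> A b -> A (t *: a + (1 - t) *: b)) ->
    (forall a, A a -> e <= N a) ->
  exists f : {linear V -> R^o},
    (forall v, f v <= N v) /\ (forall a, A a -> e <= f a).
Proof.
move=> [ND NZ] [a0 Aa0] Aconv Ae.
have N0 : N 0 = 0 by rewrite -(scale0r 0) NZ normr0 mul0r.
have NN v : N (- v) = N v by rewrite -scaleN1r NZ normrN1 mul1r.
have N_ge0 v : 0 <= N v by have := ND v (- v); rewrite subrr N0 NN; lra.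
have [|v|[s a] [t b] u v [/= s0 Aa] [/= t0 Ab]|[s a] t u [/= s0 Aa] t0|
    p sp pF] := @sublinear_inf R V (R * V)%type [set ta | 0 <= ta.1 /\ A ta.2]
    (fun ta v => N (v + ta.1 *: ta.2) - ta.1 * e).
- by exists (0, a0); split => /=.
- exists (- N v) => _ [[t a] [/= t0 Aa] <-].
  have := ND (v + t *: a) (- v); rewrite addrAC subrr add0r NN NZ ger0_norm//.
  have := Ae _ Aa; nra.
- have [st0|st0] := eqVneq (s + t) 0.
    have [-> ->] : s = 0 /\ t = 0 by split; lra.
    exists (0, a) => //=; rewrite !scale0r !addr0 !mul0r !subr0; exact: ND.
  have st_gt0 : 0 < s + t by rewrite lt_neqAle eq_sym st0 addr_ge0.
  pose c := s / (s + t).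
  exists (s + t, c *: a + (1 - c) *: b); first split=> /=.
  + exact: addr_ge0.
  + apply: Aconv => //; rewrite /c divr_ge0 ?addr_ge0//=.
    by rewrite ler_pdivrMr// mul1r lerDl.
  + rewrite /= scalerDr !scalerA.
    have -> : (s + t) * c = s by rewrite /c mulrC divfK.
    have -> : (s + t) * (1 - c) = t by rewrite /c; field.
    have := ND (u + s *: a) (v + t *: b); rewrite addrACA mulrDl; lra.
- exists (t * s, a); first by split=> //=; rewrite mulr_ge0// ltW.
  by rewrite /= -scalerA -scalerDr NZ gtr0_norm// -mulrA -mulrBr.
have [f fp] := hahn_banach sp.
exists f; split=> [v|a Aa].
  apply: le_trans (fp v) _; have := pF (0, a0) v (conj (lexx 0) Aa0).
  by rewrite /= scale0r addr0 mul0r subr0.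
have := le_trans (fp (- a)) (pF (1, a) (- a) (conj ler01 Aa)).
by rewrite /= scale1r addNr N0 mul1r sub0r raddfN lerN2.
Qed.

(** * The space of summable functions *)

Section SummableFunctions.
Variables (R : realType) (Y : choiceType).
Implicit Types (f g mu nu : Y -> R) (t : R).

Lemma l1norm_ge0 f : (0 <= l1norm f)%E.
Proof. by apply: esum_ge0 => y _; rewrite lee_fin. Qed.

Lemma l1norm0 : l1norm (0 : Y -> R) = 0%E.
Proof. by apply: esum1 => y _; rewrite normr0. Qed.

Lemma l1normD f g : (l1norm (f + g)%R <= l1norm f + l1norm g)%E.
Proof.
rewrite /l1norm -esumD => [|y _|y _]; [|by rewrite lee_fin..].
by apply: le_esum => y _; rewrite -EFinD lee_fin ler_normD.
Qed.

Lemma l1normZ t f : l1norm (t *: f) = (`|t|%:E * l1norm f)%E.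
Proof.
have le_Z s g : (l1norm (s *: g) <= `|s|%:E * l1norm g)%E.
  apply: ge_ereal_sup => _ [X [finX _] <-].
  apply: (@le_trans _ _ (`|s|%:E * \sum_(y \in X) `|g y|%:E)%E).
    rewrite !fsbig_finite//= ge0_sume_distrr => [|y _]; last by rewrite lee_fin.
    by apply: lee_sum => y _; rewrite normrM.
  by apply: lee_wpmul2l => //; apply: esum_ge; exists X.
have [->|t0] := eqVneq t 0; first by rewrite scale0r normr0 mul0e l1norm0.
apply/le_anti; rewrite le_Z/=.
rewrite -[in leLHS](scalerK t0 f).
apply: le_trans (lee_wpmul2l _ (le_Z _ _)) _ => //.
by rewrite muleA -EFinM -normrM divff// normr1 mul1e.
Qed.

Lemma l1norm_prob mu : (forall y, 0 <= mu y) ->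
  l1norm mu = (\esum_(y in [set: Y]) (mu y)%:E)%E.
Proof. by move=> mu0; apply: eq_esum => y _; rewrite ger0_norm. Qed.

Lemma prob_convex t mu nu : 0 <= t <= 1 -> Prob R Y mu -> Prob R Y nu ->
  Prob R Y (t *: (mu : Y -> R) + (1 - t) *: (nu : Y -> R)).
Proof.
move=> /andP[t0 t1] [mu0 mu1] [nu0 nu1].
have t'0 : 0 <= 1 - t by rewrite subr_ge0.
have Z0 s f y : 0 <= s -> (forall y, 0 <= f y) -> 0 <= (s *: f) y.
  by move=> s0 f0; exact: mulr_ge0.
split=> [y|]; first by rewrite addr_ge0// Z0.
rewrite l1norm_prob => [|y]; last by rewrite addr_ge0// Z0.
under eq_esum do rewrite EFinD.
rewrite esumD => [|y _|y _]; [|by rewrite lee_fin Z0..].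
rewrite -!l1norm_prob => [|y|y]; [|exact: Z0..].
rewrite !l1normZ mu1 nu1 !mule1 !ger0_norm// -EFinD; congr (_%:E); lra.
Qed.

Definition point_mass (y : Y) : Y -> R := fun z => (z == y)%:R.

Lemma l1norm_point_mass y : l1norm (point_mass y) = 1%E.
Proof.
rewrite /l1norm (esumID [set y]) => [|z _]; last by rewrite lee_fin.
rewrite setTI esum_set1 /point_mass ?eqxx ?normr1 ?lee_fin//.
rewrite esum1 ?adde0// => z [_ /= /eqP/negbTE ->]; by rewrite normr0.
Qed.

Lemma prob_point_mass y : Prob R Y (point_mass y).
Proof.
by split=> [z|]; [rewrite /point_mass ler0n|exact: l1norm_point_mass].
Qed.

Definition summable_pred : {pred Y -> R} := fun f => l1norm f \is a fin_num.

Lemma summable_submod_closed : submod_closed summable_pred.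
Proof.
split=> [|t f g Sf Sg]; first by rewrite unfold_in l1norm0.
rewrite unfold_in ge0_fin_numE ?l1norm_ge0//.
apply: le_lt_trans (l1normD _ _) _; rewrite l1normZ.
by rewrite -ge0_fin_numE ?fin_numD ?fin_numM// adde_ge0 ?mule_ge0 ?l1norm_ge0.
Qed.

Lemma point_mass_summable y : point_mass y \in summable_pred.
Proof. by rewrite unfold_in l1norm_point_mass. Qed.

HB.instance Definition _ :=
  GRing.isSubmodClosed.Build R (Y -> R) summable_pred summable_submod_closed.

Record ell1 := Ell1 { ell1val :> Y -> R ; ell1P : ell1val \in summable_pred }.

HB.instance Definition _ := [isSub for ell1val].
HB.instance Definition _ := [Choice of ell1 by <:].
HB.instance Definition _ := [SubChoice_isSubLmodule of ell1 by <:].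

Definition ell1_norm (u : ell1) : R := fine (l1norm (ell1val u)).

Lemma ell1_normE (u : ell1) : (ell1_norm u)%:E = l1norm (ell1val u).
Proof. by rewrite fineK//; exact: ell1P. Qed.

Lemma ell1_seminorm : seminorm ell1_norm.
Proof.
split=> [u v|t v].
  rewrite -lee_fin EFinD !ell1_normE -[ell1val _]/(val (u + v)) raddfD.
  exact: l1normD.
apply: EFin_inj; rewrite EFinM !ell1_normE -[ell1val _]/(val (t *: v)).
by rewrite linearZ l1normZ.
Qed.

End SummableFunctions.
Arguments point_mass {R Y}.

(** * Means *)

Section Means.
Variables (R : realType) (Y : Type).
Implicit Types (f g : Y -> R) (b : R) (m : (Y -> R) -> R).

Definition fbounded f := exists b, forall y, `|f y| <= b.

(** A mean acts on bounded functions; the last clause gives it the value 0 on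
    all others, which makes the set of means compact in the space of
    functionals on all functions.  Homogeneity on bounded functions follows
    from the first two clauses. *)
Definition is_mean m :=
  [/\ forall f g, fbounded f -> fbounded g -> m (f + g) = m f + m g,
      forall f b, fbounded f -> (forall y, f y <= b) -> m f <= b &
      forall f, ~ fbounded f -> m f = 0].

Lemma fbounded0 : fbounded 0.
Proof. by exists 0 => y; rewrite normr0. Qed.

Lemma fboundedD f g : fbounded f -> fbounded g -> fbounded (f + g).
Proof.
move=> [b fb] [c gc]; exists (b + c) => y.
exact: le_trans (ler_normD _ _) (lerD (fb y) (gc y)).
Qed.

Lemma fboundedN f : fbounded f -> fbounded (- f).
Proof. by move=> [b fb]; exists b => y; rewrite normrN. Qed.

Lemma mean0 m : is_mean m -> m 0 = 0.
Proof.
move=> [mD _ _]; have := mD 0 0 fbounded0 fbounded0; rewrite addr0; lra.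
Qed.

Lemma meanN m f : is_mean m -> fbounded f -> m (- f) = - m f.
Proof.
move=> mm fb; have [mD _ _] := mm; apply/eqP.
by rewrite -addr_eq0 addrC -mD ?subrr ?mean0//; exact: fboundedN.
Qed.

Lemma mean_ge m f b :
  is_mean m -> fbounded f -> (forall y, b <= f y) -> b <= m f.
Proof.
move=> mm fb bf; have [_ mle _] := mm; rewrite -lerN2 -meanN//.
by apply: mle => [|y]; [exact: fboundedN|rewrite lerN2 bf].
Qed.

Lemma mean_sum m (I : Type) (r : seq I) (F : I -> Y -> R) :
  is_mean m -> (forall i, fbounded (F i)) ->
  m (\sum_(i <- r) F i) = \sum_(i <- r) m (F i) /\ fbounded (\sum_(i <- r) F i).
Proof.
move=> mm Fb; have [mD _ _] := mm.
elim: r => [|i r [IHm IHb]].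
  by rewrite !big_nil mean0//; split=> //; exact: fbounded0.
by rewrite !big_cons mD// IHm; split=> //; exact: fboundedD.
Qed.

End Means.

(** * Invariant means yield almost invariant probabilities *)

Section Reiter.
Variables (R : realType) (G : groupType) (Y : choiceType) (a : G -> Y -> Y).
Hypothesis act : is_group_action a.
Implicit Types (s t : G) (f nu : Y -> R).

Lemma actK s : cancel (a s) (a s^-1%g).
Proof. by move=> y; rewrite -act.2 mulVg act.1. Qed.

Lemma actVK s : cancel (a s^-1%g) (a s).
Proof. by move=> y; rewrite -act.2 mulgV act.1. Qed.

Lemma translateM s t f :
  translate a (s * t)%g f = translate a s (translate a t f).
Proof. by apply/funext => y; rewrite /translate invgM act.2. Qed.

Lemma translate_point_mass s y :
  translate a s (point_mass y) = point_mass (a s y) :> (Y -> R).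
Proof.
apply/funext => z; rewrite /translate /point_mass; congr (nat_of_bool _)%:R.
by apply/eqP/eqP => [<-|->]; rewrite ?actVK ?actK.
Qed.

Lemma esum_act s (F : Y -> \bar R) :
  (\esum_(y in [set: Y]) F (a s y) = \esum_(y in [set: Y]) F y)%E.
Proof.
rewrite [RHS](@reindex_esum _ _ _ setT _ (a s))//.
by rewrite setTT_bijective; exists (a s^-1%g); [exact: actK|exact: actVK].
Qed.

Lemma l1norm_translate s f : l1norm (translate a s f) = l1norm f.
Proof. exact: (esum_act s^-1 (fun y => `|f y|%:E)). Qed.

Lemma prob_translate s nu : Prob R Y nu -> Prob R Y (translate a s nu).
Proof.
by move=> [nu0 nu1]; split=> [y|]; [exact: nu0|rewrite l1norm_translate].
Qed.

Lemma translateB_summable s nu : Prob R Y nu ->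
  (translate a s nu - nu : Y -> R) \in @summable_pred R Y.
Proof.
by move=> Pnu; apply: rpredB; rewrite unfold_in ?l1norm_translate Pnu.2.
Qed.

(** Day's convexity argument.  If every nu fails, the convex set A of the tuples
    (s_i nu - nu)_i in l1(Y)^n avoids the ball of radius e, so some linear f
    bounded by the norm is at least e on A.  With g_i y the value of f at the
    point mass at y in the i-th component, the case nu = point_mass y gives
    sum_i (g_i (s_i y) - g_i y) >= e; an invariant mean of the left side
    is 0. *)
Theorem invariant_mean_reiter (S : seq G) (m : (Y -> R) -> R) (e : R) :
    is_mean m -> (exists y : Y, True) ->
    (forall s f, s \in S -> m (f \o a s) = m f) -> 0 < e ->
  exists2 nu, Prob R Y nu &
    forall s, s \in S -> (l1norm (translate a s nu - nu)%R <= e%:E)%E.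
Proof.
move=> mm [y0 _] minv e0; apply: contrapT => noNu.
pose n := size S; pose s (i : 'I_n) := nth 1%g S i.
have sS i : s i \in S by exact: mem_nth.
pose V := {ffun 'I_n -> ell1 R Y}.
pose N (v : V) := \sum_i ell1_norm (v i).
have [nD nZ] := @ell1_seminorm R Y.
have n_ge0 (u : ell1 R Y) : 0 <= ell1_norm u.
  by rewrite -lee_fin ell1_normE l1norm_ge0.
have Nsemi : seminorm N.
  split=> [u v|t v]; rewrite /N.
    by rewrite -big_split/=; apply: ler_sum => i _; rewrite ffunE nD.
  by rewrite mulr_sumr; apply: eq_bigr => i _; rewrite ffunE nZ.
pose A := [set v : V | exists2 nu, Prob R Y nu &
  forall i, ell1val (v i) = translate a (s i) nu - nu].
pose D nu (Pnu : Prob R Y nu) : V :=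
  [ffun i => Ell1 (translateB_summable (s i) Pnu)].
have AD nu Pnu : A (@D nu Pnu) by exists nu => // i; rewrite ffunE.
have [|||f [fN fA]] := @seminorm_separation R V N A e Nsemi.
- by exists (D _ (prob_point_mass R y0)).
- move=> t u v t01 [mu Pmu umu] [nu Pnu vnu].
  exists (t *: mu + (1 - t) *: nu); first exact: prob_convex.
  move=> i; rewrite -[ell1val _]/(val _) !ffunE raddfD/=.
  rewrite umu vnu; apply/funext => y; rewrite /translate /= !fctE.
  by rewrite !scalerBr addrACA opprD.
- move=> v [nu Pnu vnu]; rewrite leNgt; apply/negP => Nve; apply: noNu.
  exists nu => // t /(nthP 1%g)[i iS <-].
  rewrite -(vnu (Ordinal iS)) -ell1_normE lee_fin (le_trans _ (ltW Nve))//.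
  by rewrite /N (bigD1 (Ordinal iS))//= lerDl sumr_ge0.
pose single i (u : ell1 R Y) : V := [ffun j => if j == i then u else 0].
have Nsingle i u : N (single i u) = ell1_norm u.
  rewrite /N (bigD1 i)//= ffunE eqxx big1 ?addr0// => j /negbTE ji.
  by rewrite ffunE ji /ell1_norm l1norm0.
have singleB i u v : single i (u - v) = single i u - single i v.
  by apply/ffunP => j; rewrite !ffunE; case: ifP => _; rewrite ?subr0.
have f_single i u : `|f (single i u)| <= ell1_norm u.
  rewrite ler_norml -(Nsingle i) fN andbT lerNl -raddfN.
  by rewrite (le_trans (fN _))// -scaleN1r Nsemi.2 normrN1 mul1r.
have fE (v : V) : f v = \sum_i f (single i (v i)).
  rewrite -raddf_sum; congr (f _); apply/ffunP => j; rewrite sum_ffunE.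
  rewrite (bigD1 j)//= ffunE eqxx big1 ?addr0// => i /negbTE ij.
  by rewrite ffunE eq_sym ij.
pose d y : ell1 R Y := Ell1 (point_mass_summable R y).
pose g i y : R := f (single i (d y)).
have gb i : fbounded (g i).
  exists 1 => y; apply: le_trans (f_single i (d y)) _.
  by rewrite -lee_fin ell1_normE l1norm_point_mass.
have gab i : fbounded (g i \o a (s i)).
  by have [b gib] := gb i; exists b => y; exact: gib.
pose h i := g i \o a (s i) - g i.
have hb i : fbounded (h i) by apply: fboundedD => //; exact: fboundedN.
have [mhE hsb] := @mean_sum R Y m _ (index_enum 'I_n) h mm hb.
have : e <= m (\sum_i h i).
  apply: mean_ge => // y; apply: le_trans (fA _ (AD _ (prob_point_mass R y))) _.
  rewrite fE fct_sumE; apply: ler_sum => i _.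
  suff -> : D _ (prob_point_mass R y) i = d (a (s i) y) - d y.
    by rewrite singleB raddfB.
  by apply/val_inj; rewrite ffunE raddfB /= translate_point_mass.
rewrite mhE big1 => [|i _]; first by rewrite leNgt e0.
have [mD _ _] := mm; rewrite mD//; last exact: fboundedN.
by rewrite meanN// minv// subrr.
Qed.

End Reiter.

(** * Function spaces with pointwise convergence are locally convex *)

Lemma cvg_initial (S : choiceType) (T : topologicalType) (w : S -> T)
    (I : Type) (F : set_system I) (FF : Filter F) (f : I -> S) (s : S) :
  w (f x) @[x --> F] --> w s ->
  f x @[x --> F] --> (s : initial_topology w).
Proof.
move=> fs U [_ [[A oA <-] As] AU]; apply: (filterS AU).
by apply: fs; exact: open_nbhs_nbhs.
Qed.

(** An alias that carries both the product topology and the pointwise linear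
    structure. *)
Definition fun_tvs (T : Type) (R : realType) : Type := T -> R^o.

Section FunctionSpace.
Variables (T : choiceType) (R : realType).

HB.instance Definition _ := Uniform.copy (fun_tvs T R) {ptws T -> R^o}.
HB.instance Definition _ := GRing.Lmodule.copy (fun_tvs T R) (T -> R^o).

Lemma eval_continuous (t : T) : continuous (fun f : fun_tvs T R => f t).
Proof. exact: (@proj_continuous T (fun=> R^o) t). Qed.

Lemma fun_tvs_cvg (F : set_system (fun_tvs T R)) (f : fun_tvs T R) :
  Filter F -> (forall t, g t @[g --> F] --> f t) -> F --> f.
Proof.
move=> FF Ff; apply/cvg_sup => t.
by have := @cvg_initial _ _ (fun g : T -> R^o => g t) _ F FF id f (Ff t).
Qed.

Lemma fun_tvs_hausdorff : hausdorff_space (fun_tvs T R).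
Proof.
by apply: (@hausdorff_product T (fun=> R^o)) => _; exact: norm_hausdorff.
Qed.

Lemma fun_tvs_add_continuous :
  continuous (fun x : fun_tvs T R * fun_tvs T R => x.1 + x.2).
Proof.
move=> x; apply: fun_tvs_cvg => t.
have h1 : continuous (fun z : fun_tvs T R * fun_tvs T R => z.1 t : R^o).
  by move=> z; apply: (@continuous_comp _ _ _ fst (fun f : fun_tvs T R => f t));
    [exact: cvg_fst|exact: eval_continuous].
have h2 : continuous (fun z : fun_tvs T R * fun_tvs T R => z.2 t : R^o).
  by move=> z; apply: (@continuous_comp _ _ _ snd (fun f : fun_tvs T R => f t));
  [exact: cvg_snd|exact: eval_continuous].
exact: (cvgD (h1 x) (h2 x)).
Qed.

Lemma fun_tvs_scale_continuous :
  continuous (fun z : R^o * fun_tvs T R => z.1 *: z.2).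
Proof.
move=> x; apply: fun_tvs_cvg => t.
have h1 : continuous (fun z : R^o * fun_tvs T R => z.1 : R^o).
  by move=> z; exact: cvg_fst.
have h2 : continuous (fun z : R^o * fun_tvs T R => z.2 t : R^o).
  by move=> z; apply: (@continuous_comp _ _ _ snd (fun f : fun_tvs T R => f t));
  [exact: cvg_snd|exact: eval_continuous].
exact: (@cvgM R _ _ _ _ _ _ _ (h1 x) (h2 x)).
Qed.

(** All open convex sets form a basis.  By the criterion for pointwise
    convergence it is enough to consider preimages under an evaluation of open
    convex subsets of R. *)
Lemma fun_tvs_locally_convex :
  exists2 B : set_system (fun_tvs T R), (forall b, b \in B -> convex_set b) &
    basis B.
Proof.
exists [set U | open U /\ convex_set U].
  by move=> U /set_mem[].
split=> [U []//|f]; set F := filter_from _ _.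
have FF : Filter F.
  apply: filter_from_filter.
    by exists setT; split=> //; split; [exact: openT|move=> *; exact/mem_set].
  move=> U W [[oU cU] Uf] [[oW cW] Wf]; exists (U `&` W) => //; split => //.
  split=> [|x y l /set_mem[Ux Wx] /set_mem[Uy Wy]]; first exact: openI.
  by apply/mem_set; split; apply/set_mem; [apply: cU|apply: cW]; apply/mem_set.
apply: fun_tvs_cvg => t W Wft.
have [B Bconv [Bopen Bbasis]] := @locally_convex R R^o.
have [U [BU Uft] UW] := Bbasis (f t) W Wft.
exists ((fun g : fun_tvs T R => g t) @^-1` U); last by move=> g /UW.
split=> //; split.
  by apply: open_comp; [move=> g _; exact: eval_continuous|exact: Bopen].
move=> g h l /set_mem Ug /set_mem Uh; apply/mem_set.
by apply/set_mem/(Bconv U); apply/mem_set.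
Qed.

HB.instance Definition _ := PreTopologicalNmodule_isTopologicalNmodule.Build
  (fun_tvs T R) fun_tvs_add_continuous.
HB.instance Definition _ := TopologicalNmodule_isTopologicalLmodule.Build
  R (fun_tvs T R) fun_tvs_scale_continuous.
HB.instance Definition _ :=
  Uniform_isTvs.Build R (fun_tvs T R) fun_tvs_locally_convex.

End FunctionSpace.

(** * The compact convex set of means, with the action of a group *)

Section SpaceOfMeans.
Variables (R : realType) (Y : choiceType).

Definition means : set (fun_tvs (Y -> R) R) := [set m | is_mean m].

(** A closed subset of a product of the segments [-b_f, b_f], where b_f bounds
    f, or {0} if f is unbounded. *)
Lemma means_compact : compact means.
Proof.
pose A (f : Y -> R) : set R^o :=
  if pselect (fbounded f) is left fb
  then `[- sval (cid fb), sval (cid fb)]%classic else [set 0].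
have Acompact f : compact (A f).
  rewrite /A; case: pselect => fb; first exact: segment_compact.
  exact: compact_set1.
have mA : means `<=` [set m : fun_tvs (Y -> R) R | forall f, A f (m f)].
  move=> m mm f; rewrite /A; case: pselect => fb.
  2: by have [_ _] := mm; apply.
  case: cid => b /= fb'; rewrite in_itv/=; apply/andP; split.
    by apply: mean_ge => // y; have := fb' y; rewrite ler_norml => /andP[].
  have [_ mle _] := mm; apply: mle => // y.
  by have := fb' y; rewrite ler_norml => /andP[].
apply: subclosed_compact mA; last exact: (@tychonoff _ (fun=> R^o) A Acompact).
pose E := fun_tvs (Y -> R) R.
pose D := [set fg : (Y -> R) * (Y -> R) | fbounded fg.1 /\ fbounded fg.2].
pose B := [set fb : (Y -> R) * R | fbounded fb.1 /\ forall y, fb.1 y <= fb.2].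
have -> : means =
    \bigcap_(fg in D) [set m : E | m (fg.1 + fg.2) - m fg.1 - m fg.2 = 0] `&`
    (\bigcap_(fb in B) [set m : E | m fb.1 <= fb.2] `&`
     \bigcap_(f in [set f | ~ fbounded f]) [set m : E | m f = 0]).
  apply/seteqP; split=> [m [mD mle m0]|m [mD [mle m0]]].
    split=> [[f g] [/= fb gb]|]; first by rewrite mD//; lra.
    by split=> [[f b] [/= fb fle]|f /= fb]; [exact: mle|exact: m0].
  split=> [f g fb gb|f b fb fle|f fb]; last exact: m0.
    by have := mD (f, g) (conj fb gb) => /=; lra.
  exact: (mle (f, b)).
have evc (f : Y -> R) : continuous (fun m : E => m f : R^o).
  exact: eval_continuous.
apply: closedI; last apply: closedI.
- apply: closed_bigI => -[f g] _ /=.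
  apply: (@preimage_closed _ _
    (fun m : E => m (f + g) - m f - m g : R^o) [set 0]).
    by move=> m _; exact: (cvgB (cvgB (evc (f + g) m) (evc f m)) (evc g m)).
  exact: closed_eq.
- apply: closed_bigI => -[f b] _ /=.
  apply: (@preimage_closed _ _ (fun m : E => m f : R^o) [set x | x <= b]).
    by move=> m _; exact: evc.
  exact: closed_le.
- apply: closed_bigI => f _ /=.
  apply: (@preimage_closed _ _ (fun m : E => m f : R^o) [set 0]).
    by move=> m _; exact: evc.
  exact: closed_eq.
Qed.

Lemma means_convex : convex_set means.
Proof.
move=> m m' l /set_mem[mD mle m0] /set_mem[m'D m'le m'0]; apply/mem_set.
have l0 : 0 <= l%:num by []. have l1 : 0 <= 1 - l%:num :> R by rewrite subr_ge0.
have convE f : (conv l (m : convex_lmodType (fun_tvs (Y -> R) R)) m') f =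
  l%:num * m f + (1 - l%:num) * m' f by [].
split=> [f g fb gb|f b fb fle|f fb]; rewrite !convE.
- by rewrite mD// m'D//; ring.
- have := mle f b fb fle; have := m'le f b fb fle; nra.
- by rewrite m0// m'0// !mulr0 addr0.
Qed.

Definition eval_mean (y : Y) : fun_tvs (Y -> R) R :=
  fun f => if `[< fbounded f >] then f y else 0.

Lemma eval_meanP y : means (eval_mean y).
Proof.
split=> [f g fb gb|f b fb fle|f fb]; rewrite /eval_mean.
- by have fgb := fboundedD fb gb; rewrite !asboolT.
- by rewrite asboolT.
- by rewrite asboolF.
Qed.

Definition eval_point (y : Y) : means :=
  exist (fun m => m \in means) _ (mem_set (eval_meanP y)).

Variables (G : groupType) (a : G -> Y -> Y).
Hypothesis act : is_group_action a.

Lemma fbounded_act s (f : Y -> R) : fbounded (f \o a s) <-> fbounded f.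
Proof.
split=> -[b fb]; exists b => y; last exact: fb.
by have := fb (a s^-1%g y); rewrite /= actVK.
Qed.

Lemma mean_act_is_mean s (m : means) :
  (fun f => \val m (f \o a s)) \in means.
Proof.
case: m => m /= /set_mem[mD mle m0]; apply/mem_set.
split=> [f g fb gb|f b fb fle|f fb].
- by rewrite -mD//; exact/fbounded_act.
- by apply: mle => [|y]; [exact/fbounded_act|exact: fle].
- by apply: m0 => /fbounded_act.
Qed.

Definition mean_act s (m : means) : means :=
  exist (fun m => m \in means) _ (mean_act_is_mean s m).

Lemma mean_act_action : is_group_action mean_act.
Proof.
split=> [m|s t m]; apply/val_inj/funext => f /=; congr (\val m _).
  by apply/funext => y /=; rewrite act.1.
by apply/funext => y /=; rewrite act.2.
Qed.

Lemma mean_act_continuous s : continuous (mean_act s).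
Proof.
apply: (@continuous_comp_initial _ _ _ (\val : means -> fun_tvs (Y -> R) R)).
move=> m; apply: fun_tvs_cvg => [|f /=].
  exact: (@fmap_filter _ _ _ _ (@nbhs_filter _ _)).
apply: (@continuous_comp _ _ _ (\val : means -> fun_tvs (Y -> R) R)
  (fun m' : fun_tvs (Y -> R) R => m' (f \o a s))).
  exact: initial_continuous.
exact: eval_continuous.
Qed.

Lemma mean_act_affine s : affine_on (mean_act s).
Proof. by move=> t x y z _ zE; apply/funext => f /=; rewrite zE. Qed.

Lemma mean_act_eval s y : a s y = y ->
  mean_act s (eval_point y) = eval_point y.
Proof.
move=> sy; apply/val_inj/funext => f /=; rewrite /eval_mean /= sy.
by congr (if _ then _ else _); apply: asbool_equiv_eq; exact: fbounded_act.
Qed.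

End SpaceOfMeans.

(** * Cosets and their representatives *)

Section CosetSpace.
Variables (G : groupType) (L : groupClosed G).
Implicit Types (g h s : G) (A : left_cosets L).

Definition coset_of_elt g : left_cosets L :=
  exist (fun B => B \in left_cosets L) _ (mem_set (imageT (left_coset L) g)).

Lemma coset_of_elt_surj A : exists g, coset_of_elt g = A.
Proof.
case: A => A A'; have [g _ gA] := set_mem A'.
by exists g; apply/val_inj.
Qed.

Lemma coset_act_elt s g : coset_act s (coset_of_elt g) = coset_of_elt (s * g)%g.
Proof.
apply/val_inj; rewrite /= /left_coset image_comp.
by apply/eq_imagel => h _ /=; rewrite mulgA.
Qed.

Lemma coset_of_eltP g h :
  coset_of_elt g = coset_of_elt h <-> (g^-1 * h)%g \in L.
Proof.
split=> [/(congr1 \val)/= gh|ghL].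
  have : left_coset L h h by exists 1%g; rewrite ?mulg1//=; exact: gpred1.
  by rewrite -gh => -[k /= kL <-]; rewrite mulKg.
apply/val_inj/seteqP; split=> _ [k /= kL <-].
  exists ((g^-1 * h)^-1 * k)%g; last by rewrite invgM invgK !mulgA mulgV mul1g.
  by rewrite /= gpredM// gpredV.
exists ((g^-1 * h) * k)%g; last by rewrite !mulgA mulgV mul1g.
by rewrite /= gpredM.
Qed.

Definition coset_rep A : G := sval (cid (coset_of_elt_surj A)).

Lemma coset_repK A : coset_of_elt (coset_rep A) = A.
Proof. by rewrite /coset_rep; case: cid. Qed.

End CosetSpace.

(** * From fixed points to amenability *)

Lemma ereal_cvg0 (R : realType) (I : Type) (F : set_system I) (FF : Filter F)
    (f : I -> \bar R) :
  (forall e, 0 < e -> \forall i \near F, (0 <= f i <= e%:E)%E) ->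
  f i @[i --> F] --> 0%E.
Proof.
move=> fe; apply/fine_cvgP; split.
  have := fe 1 ltr01; apply: filterS => i /andP[f0 f1].
  by rewrite ge0_fin_numE// (le_lt_trans f1)// ltry.
apply/cvgrPdist_le => e e0; have := fe e e0; apply: filterS => i /andP[f0 fle].
rewrite sub0r normrN /= ger0_norm ?fine_ge0// -lee_fin fineK//.
by rewrite ge0_fin_numE// (le_lt_trans fle)// ltry.
Qed.

Lemma net_filter_proper (I : Type) (le : rel I) :
  directed_set le -> ProperFilter (net_filter le).
Proof.
move=> [[i0] le_refl le_trans dir]; apply: filter_from_proper.
  apply: filter_from_filter; first by exists i0.
  move=> i j _ _; have [k /andP[ik jk]] := dir i j.
  by exists k => // l /= kl; split; [exact: le_trans kl|exact: le_trans kl].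
by move=> i _; exists i; exact: le_refl.
Qed.

(** The net is indexed by pairs (S, n) of a finite list of elements of G and a
    tolerance 1/(n+1).  Compactness of K in a discrete space enters as the
    near-covering property, which makes an eventual estimate at each point of K
    uniform on K. *)
Theorem coamenable_rel_amenable (R : realType) (G : groupType)
    (L1 L2 : groupClosed G) :
  coamenable_relative R L1 L2 -> rel_amenable R L1 (coset_space L2).
Proof.
pose Y : choiceType := left_cosets L1; pose act := coset_act_action L1.
move=> /(_ (fun_tvs (Y -> R) R) (@means R Y) (mean_act act)).
case=> [||||||s||m mfix].
- exact: fun_tvs_hausdorff.
- by exists (eval_mean (coset_of_elt L1 1%g)); exact: eval_meanP.
- exact: means_compact.
- exact: means_convex.
- exact: mean_act_action.
- exact: mean_act_continuous.
- exact: mean_act_affine.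
- exists (eval_point R (coset_of_elt L1 1%g)) => s sL1; apply: mean_act_eval.
  rewrite coset_act_elt; apply/coset_of_eltP.
  by rewrite !mulg1 gpredV.

pose I : Type := (seq G * nat)%type.
pose le (i j : I) := all (mem j.1) i.1 && (i.2 <= j.2)%N.
have /choice[nu nuP] : forall i : I, exists nu : Y -> R, Prob R Y nu /\
    forall s, s \in i.1 -> s \in L2 ->
      (l1norm (translate (@coset_act G L1) s nu - nu)%R <= (i.2.+1%:R^-1)%:E)%E.
  move=> i.
  have e0 : 0 < i.2.+1%:R^-1 :> R by rewrite invr_gt0 ltr0n.
  have [||s f||mu Pmu muS] := @invariant_mean_reiter R G Y _ act
    [seq s <- i.1 | s \in L2] (\val m) i.2.+1%:R^-1.
  - by case: m {mfix} => m /= /set_mem.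
  - by exists (coset_of_elt L1 1%g).
  - rewrite mem_filter => /andP[sL2 _].
    by have /(congr1 \val)/(congr1 (fun m => m f)) := mfix s sL2.
  - exact: e0.
  - by exists mu; split=> // s si sL2; apply: muS; rewrite mem_filter sL2.
pose mu (i : I) (x : coset_space L2) : Prob R Y :=
  exist (fun nu => nu \in Prob R Y) _
    (mem_set (prob_translate act (coset_rep x) (nuP i).1)).
have dir : directed_set le.
  split=> [|i|j i k /andP[/allP ij ij2] /andP[/allP jk jk2]|i j].
  - by constructor; exact: ([::], 0%N).
  - by rewrite /le leqnn andbT; apply/allP.
  - rewrite /le (leq_trans ij2)// andbT; apply/allP => s /ij; exact: jk.
  - exists (i.1 ++ j.1, maxn i.2 j.2); rewrite /le/= leq_maxl leq_maxr !andbT.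
    by apply/andP; split; apply/allP => s; rewrite inE mem_cat => ->;
      rewrite ?orbT.
have FF := net_filter_proper dir.
exists I, le, mu; split=> // [i x U /nbhs_singleton Ux|s K].
  by rewrite nbhs_principalE; exact/principal_filterP.
move=> /compact_near_coveringP cK.
apply: ereal_cvg0 => e e0.
suff : \forall i \near net_filter le, K `<=` [set x |
    (l1norm (fun y => translate (@coset_act G L1) s (\val (mu i x)) y
      - \val (mu i (lcgact s x)) y)%R <= e%:E)%E].
  apply: filterS => i Ke; apply/andP; split.
    by apply: ereal_sup_ubound; left.
  apply: ge_ereal_sup => _ [->|[x Kx <-]]; first by rewrite lee_fin ltW.
  exact: Ke.
apply: cK => x _.
pose g := coset_rep x; pose h := coset_rep (lcgact s x : left_cosets L2).
pose k := (h^-1 * (s * g))%g.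
have kL2 : k \in L2.
  apply/coset_of_eltP; rewrite coset_repK -coset_act_elt coset_repK.
  exact: erefl.
have [n ne] : exists n : nat, n.+1%:R^-1 <= e.
  have [n] := ltr_add_invr (y := 0) (x := e) e0.
  by rewrite add0r => /ltW ne; exists n.
exists ([set x], [set i | le ([:: k], n) i]).
  split; first by rewrite nbhs_principalE; exact/principal_filterP.
  by exists ([:: k], n).
move=> [_ i] /= [-> /andP[/= /andP[ki _] ni]].
pose tr := translate (R := R) (@coset_act G L1).
have -> : (fun y => tr s (tr g (nu i)) y - tr h (nu i) y) =
          tr h (tr k (nu i) - nu i).
  have hk : tr h (tr k (nu i)) = tr s (tr g (nu i)).
    by rewrite /tr -!(translateM act) /k mulVKg.
  by rewrite -hk.
rewrite l1norm_translate//; apply: le_trans ((nuP i).2 k ki kL2) _.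
rewrite lee_fin (le_trans _ ne)// lef_pV2 ?posrE ?ltr0Sn//.
by rewrite ler_nat ltnS.
Qed.

(** * Limits along ultrafilters *)

Lemma ultra_fmap (I T : Type) (f : I -> T) (U : set_system I) :
  UltraFilter U -> UltraFilter (f @ U).
Proof.
move=> UU; split; first exact: fmap_proper_filter.
move=> F FF UF; apply/seteqP; split=> // A FA.
have [//|UnA] := in_ultra_setVsetC (f @^-1` A) UU.
have FnA : F (~` A) by exact: UF.
by have [x []] := filter_ex (filterI FA FnA).
Qed.

Lemma compact_ultra_lim (T : topologicalType) (K : set T) (I : Type)
    (U : set_system I) (f : I -> T) : UltraFilter U -> compact K ->
  (forall i, K (f i)) -> exists2 p, K p & f i @[i --> U] --> p.
Proof.
move=> UU; rewrite compact_ultra => cK fK.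
have [|p [Kp fp]] := cK _ (ultra_fmap f UU); last by exists p.
by rewrite /fmap/=; exact: filterE.
Qed.

(** * Barycenters in a convex set *)

(** A nonnegative finite combination of points of C is its total mass W times a
    point z of C, and affine maps respect this.  Working with total masses
    avoids normalization and covers W = 0, where z is arbitrary. *)
Lemma nneg_combination (R : realType) (E : lmodType R) (C : set E) (T : Type)
    (r : seq T) (w : T -> R) (phi : T -> C) :
    convex_set C -> C !=set0 -> (forall t, 0 <= w t) ->
  exists z : C,
    \sum_(t <- r) w t *: \val (phi t) = (\sum_(t <- r) w t) *: \val z /\
    forall f : C -> C, affine_on f ->
      \sum_(t <- r) w t *: \val (f (phi t)) = (\sum_(t <- r) w t) *: \val (f z).
Proof.
move=> Cconv [c0 Cc0] w0; elim: r => [|t r [z [zE zaff]]].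
  exists (exist (fun c => c \in C) _ (mem_set Cc0)).
  by split=> [|f _]; rewrite !big_nil scale0r.
rewrite [\sum_(t <- t :: r) w t]big_cons.
have : 0 <= \sum_(t <- r) w t by exact: sumr_ge0.
move: (\sum_(t <- r) w t) zE zaff => W zE zaff W0.
have [wW0|wW0] := eqVneq (w t + W) 0.
  have wt0 : w t = 0 by have := w0 t; lra.
  have W00 : W = 0 by lra.
  exists z; split=> [|f faff]; rewrite !big_cons.
    by rewrite zE wt0 W00 !scale0r !addr0 scale0r.
  by rewrite zaff// wt0 W00 !scale0r !addr0 scale0r.
have wW_gt0 : 0 < w t + W by rewrite lt_neqAle eq_sym wW0 addr_ge0.
pose l := w t / (w t + W).
have l0 : 0 <= l by rewrite divr_ge0// ltW.
have l1 : l <= 1 by rewrite ler_pdivrMr// mul1r lerDl.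
have lE : (w t + W) * l = w t by rewrite mulrC divfK.
have l'E : (w t + W) * (1 - l) = W by rewrite /l; field.
have Cy : l *: \val (phi t) + (1 - l) *: \val z \in C.
  exact: (Cconv _ _ (Itv01 l0 l1) (valP (phi t)) (valP z)).
exists (exist (fun c => c \in C) _ Cy); split=> [|f faff]; rewrite !big_cons.
  by rewrite /= zE scalerDr !scalerA lE l'E.
by rewrite zaff// [in RHS](faff l (phi t) z) ?l0// scalerDr !scalerA lE l'E.
Qed.

(** The positive and the negative part of the weights each give one point. *)
Lemma signed_combination (R : realType) (E : lmodType R) (C : set E) (T : Type)
    (r : seq T) (w : T -> R) (phi : T -> C) :
    convex_set C -> C !=set0 ->
  exists P N (p q : C),
    [/\ 0 <= P <= \sum_(t <- r) `|w t|, 0 <= N <= \sum_(t <- r) `|w t| &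
     \sum_(t <- r) w t *: \val (phi t) = P *: \val p - N *: \val q].
Proof.
move=> Cconv C0; pose wp t := Num.max (w t) 0; pose wn t := Num.max (- w t) 0.
have wp0 t : 0 <= wp t by rewrite le_max lexx orbT.
have wn0 t : 0 <= wn t by rewrite le_max lexx orbT.
have [p [pE _]] := nneg_combination r phi Cconv C0 wp0.
have [q [qE _]] := nneg_combination r phi Cconv C0 wn0.
exists (\sum_(t <- r) wp t), (\sum_(t <- r) wn t), p, q; split.
- rewrite sumr_ge0//=; apply: ler_sum => t _.
  by rewrite /wp ge_max ler_norm normr_ge0.
- rewrite sumr_ge0//=; apply: ler_sum => t _.
  by rewrite /wn ge_max -[`|_|]normrN ler_norm normr_ge0.
- rewrite -pE -qE -sumrB; apply: eq_bigr => t _.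
  rewrite -scalerBl /wp /wn; congr (_ *: _).
  have [wt0|] := boolP (0 <= w t); last rewrite -ltNge => /ltW wt0.
    by rewrite max_l// max_r ?oppr_le0// subr0.
  by rewrite max_r// max_l ?oppr_ge0// sub0r opprK.
Qed.

Lemma sum_le_l1norm (R : realType) (Y : choiceType) (r : seq Y) (f : Y -> R) :
  uniq r -> ((\sum_(y <- r) `|f y|)%:E <= l1norm f)%E.
Proof.
move=> ur; apply: esum_ge; exists [set` r].
  by split=> //; exact: finite_seq.
by rewrite -fsbig_seq// sumEFin.
Qed.

Lemma prob_finite_approx (R : realType) (Y : choiceType) (nu : Y -> R) (e : R) :
  Prob R Y nu -> 0 < e ->
  exists2 r : seq Y, uniq r & 1 - e <= \sum_(y <- r) nu y.
Proof.
move=> [nu0 nu1] e0.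
have : ((1 - e)%:E < \esum_(y in [set: Y]) `|nu y|%:E)%E.
  by rewrite [ltRHS]nu1 lte_fin ltrBlDr ltrDl.
move=> /ereal_sup_gt[_ [X [finX _] <-]].
rewrite fsbig_finite// sumEFin lte_fin => /ltW eX.
exists (finmap.enum_fset (fset_set X)); first exact: finmap.fset_uniq.
by under eq_bigr do rewrite -[nu _]ger0_norm//.
Qed.

Lemma big_widen (V : nmodType) (Y : eqType) (r L : seq Y) (F : Y -> V) :
  uniq r -> uniq L -> {subset r <= L} ->
  \sum_(y <- r) F y = \sum_(y <- L) if y \in r then F y else 0.
Proof.
move=> ur uL rL; rewrite -big_mkcond -big_filter; apply: perm_big.
apply: uniq_perm => // [|y]; first exact: filter_uniq.
by rewrite mem_filter; apply/idP/andP => [yr|[]//]; split=> //; exact: rL.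
Qed.

(** * From amenability to fixed points *)

Section AlmostFixedPoint.
Variables (R : realType) (G : groupType) (E : lmodType R) (C : set E).
Variables (a : G -> C -> C) (Y : choiceType) (b : G -> Y -> Y) (phi : Y -> C).
Hypothesis Cconv : convex_set C.
Hypothesis C_neq0 : C !=set0.
Hypothesis a_affine : forall s, affine_on (a s).
Hypothesis b_action : is_group_action b.
Hypothesis phi_equiv : forall s y, phi (b s y) = a s (phi y).

(** Restrict nu to a finite list r of mass W >= 1 - e, with barycenter z.  Then
    W (sz - z) is the combination of the points phi y whose weights are the
    difference w of s nu on sr and nu on r.  Each of the two truncations changes
    the l1 norm by at most e. *)
Lemma almost_fixed_barycenter (nu : Y -> R) (e : R) :
    Prob R Y nu -> 0 < e ->
  exists (z : C) (W : R), 1 - e <= W <= 1 /\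
    forall s, exists P N (p q : C),
      let d := fine (l1norm (translate b s nu - nu)) + e *+ 2 in
      [/\ 0 <= P <= d, 0 <= N <= d &
        W *: (\val (a s z) - \val z) = P *: \val p - N *: \val q].
Proof.
move=> Pnu e0; have [nu0 nu1] := Pnu.
have [r ur er] := prob_finite_approx Pnu e0.
have sum_le1 (f : Y -> R) (L : seq Y) :
    Prob R Y f -> uniq L -> \sum_(y <- L) f y <= 1.
  move=> [f0 f1] uL; have := sum_le_l1norm f uL; rewrite [l1norm f]f1 lee_fin.
  by under eq_bigr do rewrite ger0_norm//.
have [z [zE zaff]] := nneg_combination r phi Cconv C_neq0 nu0.
move: er (sum_le1 _ _ Pnu ur) zE zaff.
move WE: (\sum_(y <- r) nu y) => W eW W1 zE zaff.
exists z, W; rewrite eW W1; split=> // s.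
pose r' := map (b s) r; pose L := undup (r ++ r').
have ur' : uniq r' by rewrite map_inj_uniq//; exact: can_inj (actK b_action s).
have rL : {subset r <= L} by move=> y yr; rewrite mem_undup mem_cat yr.
have r'L : {subset r' <= L} by move=> y yr; rewrite mem_undup mem_cat yr orbT.
have uL : uniq L by exact: undup_uniq.
pose snu := translate b s nu.
have Psnu : Prob R Y snu := prob_translate b_action s Pnu.
have sum_r' (V : lmodType R) (F : R -> Y -> V) :
    \sum_(y <- r') F (snu y) y = \sum_(y <- r) F (nu y) (b s y).
  by rewrite big_map; apply: eq_bigr => y _; rewrite /snu /translate actK.
pose w y := (if y \in r' then snu y else 0) - (if y \in r then nu y else 0).
have wE : W *: (\val (a s z) - \val z) = \sum_(y <- L) w y *: \val (phi y).
  rewrite scalerBr -zE -zaff//.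
  under eq_bigr do rewrite -phi_equiv.
  rewrite -(sum_r' E (fun t y => t *: \val (phi y))).
  rewrite (big_widen _ ur uL rL) (big_widen _ ur' uL r'L) -sumrB.
  apply: eq_bigr => y _; rewrite /w scalerBl.
  by congr (_ - _); case: ifP => _; rewrite ?scale0r.
have wle : \sum_(y <- L) `|w y| <= fine (l1norm (snu - nu)) + e *+ 2.
  apply: (@le_trans _ _ (\sum_(y <- L) (`|(snu - nu) y| +
      (snu y - (if y \in r' then snu y else 0)) +
      (nu y - (if y \in r then nu y else 0))))).
    apply: ler_sum => y _; rewrite /w !fctE.
    have := nu0 y; have : 0 <= snu y by exact: nu0.
    have := ler_norm (snu y - nu y); have := ler_norm (nu y - snu y).
    rewrite [`|nu y - _|]distrC; move: `|snu y - nu y| => D D1 D2 snu0 nu0'.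
    rewrite ler_norml.
    by case: (y \in r'); case: (y \in r); apply/andP; split; lra.
  rewrite !big_split/= !sumrN -!big_widen//.
  rewrite (sum_r' R^o (fun t _ => t)) WE.
  have := sum_le1 _ _ Pnu uL; have := sum_le1 _ _ Psnu uL.
  have Sfin : l1norm (snu - nu)%R \is a fin_num by exact: translateB_summable.
  have := sum_le_l1norm (snu - nu) uL; rewrite -[l1norm _]fineK// lee_fin.
  move: (fine _) => D; rewrite -/snu /=; lra.
have [P [N [p [q [PS NS pqE]]]]] := signed_combination L w phi Cconv C_neq0.
exists P, N, p, q; case/andP: PS => P0 PS; case/andP: NS => N0 NS.
by split; [rewrite P0 (le_trans PS)|rewrite N0 (le_trans NS)|rewrite wE].
Qed.

End AlmostFixedPoint.

(** The net index i and the truncation error 1/(n+1) form one index j = (i, n);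
    an ultrafilter finer than the product filter makes all families of points of
    C converge at once. *)
Theorem amenable_coamenable (R : realType) (G : groupType)
    (L1 L2 : groupClosed G) :
  rel_amenable R L1 (coset_space L2) -> coamenable_relative R L1 L2.
Proof.
move=> [I [le [mu [dir _ mu_inv]]]].
move=> E C a hE C0 cC Cconv act a_cont a_aff [c cfix].
pose Y : choiceType := left_cosets L1; pose Yact := coset_act_action L1.
pose phi (A : Y) : C := a (coset_rep A) c.
have phi_equiv s A : phi (coset_act s A) = a s (phi A).
  rewrite /phi -act.2; set g := coset_rep _; set h := (s * _)%g.
  have ghL : (g^-1 * h)%g \in L1.
    by apply/coset_of_eltP; rewrite /h -coset_act_elt !coset_repK.
  by rewrite -[h](mulVKg g) act.2 (cfix _ ghL).
pose x0 : coset_space L2 := coset_of_elt L2 1%g.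
pose nu i : Y -> R := \val (mu i x0).
have Pnu i : Prob R Y (nu i) by exact: set_mem (valP (mu i x0)).
have FF := net_filter_proper dir.
pose d s i := fine (l1norm (translate (@coset_act G L1) s (nu i) - nu i)).
have d0 s : s \in L2 -> d s i @[i --> net_filter le] --> (0 : R).
  move=> sL2.
  have sx0 : coset_act s (x0 : left_cosets L2) = x0.
    by rewrite /x0/= coset_act_elt; apply/coset_of_eltP; rewrite !mulg1 gpredV.
  have /fine_cvgP[fin /cvgrPdist_le dist] :=
    mu_inv s [set x0] (@compact_set1 _ x0).
  apply/cvgrPdist_le => e /dist; apply: filter_app.
  move: fin; apply: filterS => i fin.
  rewrite !sub0r !normrN /=; apply: le_trans.
  rewrite ger0_norm ?fine_ge0 ?l1norm_ge0//; apply: le_trans (ler_norm _).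
  rewrite fine_le//; first by have := translateB_summable Yact s (Pnu i).
  apply: ereal_sup_ubound; right; exists x0 => //.
  by rewrite /= sx0.
have n0 n : 0 < n.+1%:R^-1 :> R by rewrite invr_gt0 ltr0n.
have /choice[z /choice[W zWP]] := fun j : I * nat => almost_fixed_barycenter
  Cconv C0 a_aff Yact phi_equiv (Pnu j.1) (n0 j.2).
have [U [UU FU]] :=
  ultraFilterLemma (@filter_prod_proper _ _ _ _ FF eventually_filter).
have UF (f : I * nat -> R) (l : R) :
    f j @[j --> filter_prod (net_filter le) \oo] --> l -> f j @[j --> U] --> l.
  by move=> fl A /fl; exact: FU.
have jn0 : (j.2.+1%:R^-1 : R) @[j --> U] --> (0 : R).
  apply: UF; exact: (cvg_comp (fun j : I * nat => j.2) (@harmonic R)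
    cvg_snd cvg_harmonic).
have jd0 s : s \in L2 -> (d s j.1 + j.2.+1%:R^-1 *+ 2) @[j --> U] --> (0 : R).
  move=> sL2; have jd : d s j.1 @[j --> U] --> (0 : R).
    apply: UF; exact: (cvg_comp (fun j : I * nat => j.1) (d s)
      cvg_fst (d0 s sL2)).
  rewrite -[0 in X in _ --> X](addr0 0) -[0 in X in _ --> 0 + X](addr0 0).
  exact: cvgD jd (cvgD jn0 jn0).
have W1 : W j @[j --> U] --> (1 : R^o).
  apply: (@squeeze_cvgr _ _ _ _ (fun j => 1 - j.2.+1%:R^-1) (cst 1)).
  - by apply: nearW => j; have [] := zWP j.
  - by rewrite -[1 in X in _ --> X](subr0 1); apply: cvgB jn0; exact: cvg_cst.
  - exact: cvg_cst.
have lim_in_C (y : I * nat -> C) : exists y0 : C, y j @[j --> U] --> y0.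
  have [y0 Cy0 y0P] := compact_ultra_lim UU cC (fun j => set_mem (valP (y j))).
  exists (exist (fun c => c \in C) y0 (mem_set Cy0)).
  exact: (@cvg_initial _ _ (\val : C -> E) _ U _ y).
have val_lim (y : I * nat -> C) (y0 : C) :
    y j @[j --> U] --> y0 -> \val (y j) @[j --> U] --> \val y0.
  move=> yy0; apply: (cvg_comp _ _ yy0).
  exact: (@initial_continuous _ _ (\val : C -> E)).
have [z0 zz0] := lim_in_C z.
exists z0 => s sL2.
have azz0 : a s (z j) @[j --> U] --> a s z0.
  by apply: (cvg_comp _ _ zz0); exact: a_cont.
have scale_lim (k : I * nat -> R^o) (v : I * nat -> E) (k0 : R^o) (v0 : E) :
    k j @[j --> U] --> k0 -> v j @[j --> U] --> v0 ->
    (k j *: v j) @[j --> U] --> k0 *: v0.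
  move=> kk0 vv0.
  exact: (cvg_comp (fun j => (k j, v j)) (fun kv : R^o * E => kv.1 *: kv.2)
    (cvg_pair kk0 vv0) (@scale_continuous R E (k0, v0))).
have sub_lim (u v : I * nat -> E) (u0 v0 : E) :
    u j @[j --> U] --> u0 -> v j @[j --> U] --> v0 ->
    (u j - v j) @[j --> U] --> u0 - v0.
  move=> uu0 vv0.
  exact: (cvg_comp (fun j => (u j, v j)) (fun uv : E * E => uv.1 - uv.2)
    (cvg_pair uu0 vv0) (@sub_continuous E (u0, v0))).
have /choice[k kP] : forall j, exists k : (R * R) * (C * C),
    [/\ 0 <= k.1.1 <= d s j.1 + j.2.+1%:R^-1 *+ 2,
        0 <= k.1.2 <= d s j.1 + j.2.+1%:R^-1 *+ 2 &
        W j *: (\val (a s (z j)) - \val (z j)) =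
          k.1.1 *: \val k.2.1 - k.1.2 *: \val k.2.2].
  move=> j; have [_ /(_ s)[P [N [p [q PNpq]]]]] := zWP j.
  by exists ((P, N), (p, q)).
have P0 : (k j).1.1 @[j --> U] --> (0 : R^o).
  apply: (squeeze_cvgr _ (cvg_cst 0) (jd0 s sL2)).
  by apply: nearW => j; have [] := kP j.
have N0 : (k j).1.2 @[j --> U] --> (0 : R^o).
  apply: (squeeze_cvgr _ (cvg_cst 0) (jd0 s sL2)).
  by apply: nearW => j; have [] := kP j.
have [p0 pp0] := lim_in_C (fun j => (k j).2.1).
have [q0 qq0] := lim_in_C (fun j => (k j).2.2).
have lhs := scale_lim _ _ _ _ W1
  (sub_lim _ _ _ _ (val_lim _ _ azz0) (val_lim _ _ zz0)).
have rhs := sub_lim _ _ _ _ (scale_lim _ _ _ _ P0 (val_lim _ _ pp0))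
  (scale_lim _ _ _ _ N0 (val_lim _ _ qq0)).
have lhs_rhs : (fun j => W j *: (\val (a s (z j)) - \val (z j))) =
   (fun j => (k j).1.1 *: \val (k j).2.1 - (k j).1.2 *: \val (k j).2.2).
  by apply/funext => j; have [] := kP j.
rewrite lhs_rhs in lhs.
have := @cvg_unique _ hE _ (fmap_proper_filter _ (@ultra_proper _ U UU)) _ _
  lhs rhs.
by rewrite scale1r !scale0r subrr => /subr0_eq /val_inj.
Qed.

Theorem mainTheorem4 (R : realType) (G : groupType) (L1 L2 : groupClosed G) :
  rel_amenable R L1 (coset_space L2) <-> coamenable_relative R L1 L2.
Proof.
by split; [exact: amenable_coamenable|exact: coamenable_rel_amenable].
Qed.
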